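(* Let $\mathcal{B}$ be any board and let $q\ge 1$ be an integer. For riders $\mathbb{P}$ with exactly $3$ basic moves, the number of unlabelled combinatorial types of nonattacking configurations of $q$ copies of $\mathbb{P}$ on dilations of $\mathcal{B}$ is independent of the move set; that is, any two riders with $3$ basic moves have the same number of unlabelled combinatorial types of nonattacking configurations of $q$ copies. Moreover, the set of combinatorial types is independent of the move set up to reorientation: if $\mathbf{M}=\{m_1,m_2,m_3\}$ and $\mathbf{M}'=\{m_1',m_2',m_3'\}$ are any two move sets with $3$ basic moves, then the sets of combinatorial types of $q$ copies, on dilations of $\mathcal{B}$, of the rider with move set $\mathbf{M}$ and of the rider with move set $\mathbf{M}'$ are equal up to reorientation.
   Context: **Board.** A board $\mathcal{B}$ is a closed, bounded, convex polygonal region in $\mathbb{R}^2$ with nonempty interior $\mathcal{B}^\circ$. (Its vertices need not be rational.) The working board of order $n$ (for an integer $n\ge 1$) is $(n+1)\mathcal{B}^\circ\cap\mathbb{Z}^2$. ''On dilations of the board'' means that all orders $n$ are allowed. **Rider.** A rider $\mathbb{P}$ with $r$ basic moves is given by its move set $\mathbf{M}=\{m_1,\dots,m_r\}$ of nonzero vectors $m_j=(c_j,d_j)\in\mathbb{R}^2$, no two of which are parallel; equivalently, the slopes $\mu_j=d_j/c_j\in\mathbb{R}\cup\{\infty\}$ are distinct. (For actual chess pieces the $m_j$ are integer vectors, but rationality of the slopes is not needed for combinatorial types.) A piece at $z_0$ attacks every point $z$ with $z-z_0=\lambda m_j$ for some $j$ and some $\lambda\in\mathbb{R}$; the line through $z_0$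 in direction $m_j$ is its $j$-th move line. **Nonattacking configuration.** A nonattacking configuration of $q$ labelled copies $\mathbb{P}_1,\dots,\mathbb{P}_q$ of $\mathbb{P}$ on the board of order $n$ is a $q$-tuple $(z_1,\dots,z_q)$ of points of $(n+1)\mathcal{B}^\circ\cap\mathbb{Z}^2$ such that $z_k$ does not lie on any move line through $z_i$ whenever $i\ne k$. **Combinatorial type.** Orient each move line by the direction of its basic move, so that it has a left side and a right side. The labelled combinatorial type of a nonattacking configuration is the function that assigns to each triple $(i,j,k)$ with $i,k\in\{1,\dots,q\}$, $i\neq k$, $j\in\{1,\dots,r\}$, the side (left or right) of the $j$-th move line of $\mathbb{P}_i$ on which $\mathbb{P}_k$ lies, i.e. the sign of $\det(m_j, z_k-z_i)$. An unlabelled combinatorial type is an equivalence class of labelled combinatorial types under permutation of the labels $1,\dots,q$ of the pieces. The set of combinatorial types (labelled or unlabelled) of $q$ copies of $\mathbb{P}$ on dilations of $\mathcal{B}$ is the set of all types that occur for nonattacking configurations on the working board of some order $n\ge1$. **Reorientation.** Reversing a set of basic moves (replacing $m_j$ by $-m_j$ for all $j$ in some $S\subseteq\{1,\dots,r\}$) interchanges left and right in the values at all triples $(i,j,k)$ with $j\in S$. Two sets of combinatorial types are equal up to reorientation if for some $S\subseteq\{1,\dots,r\}$ one is obtained from the other by interchanging left and right in all values at triples $(i,j,k)$ with $j\in S$, for every type in the set. *)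

(* Defs.v *)
From mathcomp Require Import all_boot all_order all_algebra all_fingroup.
From mathcomp Require Import all_classical all_reals all_analysis.
Import numFieldNormedType.Exports.

Set Implicit Arguments.
Unset Strict Implicit.
Unset Printing Implicit Defensive.

Import Order.TTheory GRing.Theory Num.Theory.
Local Open Scope ring_scope.

Section Geometry.
Variable R : realType.
Implicit Types (B : set 'rV[R]_2) (u v x : 'rV[R]_2).

Definition hull (n : nat) (v : 'I_n -> 'rV[R]_2) : set 'rV[R]_2 :=
  [set x | exists w : 'I_n -> R,
     [/\ forall i, 0 <= w i, \sum_i w i = 1 & x = \sum_i w i *: v i]]%classic.

(* A closed, bounded, convex polygonal region is the convex hull of finitely
   many points; a nonempty interior excludes points and segments. *)
Definition board B : Prop :=
  (exists (n : nat) (v : 'I_n -> 'rV[R]_2), B = hull v) /\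
  (interior B !=set0)%classic.

Definition working_board B (n : nat) : set 'rV[R]_2 :=
  ([set n.+1%:R *: x | x in interior B] `&`
   [set map_mx intr a | a in [set: 'rV[int]_2]])%classic.

(* Only used when u is nonzero. *)
Definition parallel u v : Prop := exists c : R, v = c *: u.

Definition move_set (r : nat) (M : 'I_r -> 'rV[R]_2) : Prop :=
  (forall j, M j != 0) /\ (forall j k, j != k -> ~ parallel (M j) (M k)).

Definition attacks (r : nat) (M : 'I_r -> 'rV[R]_2) u v : Prop :=
  exists (j : 'I_r) (c : R), v - u = c *: M j.

Definition nonattacking B (r : nat) (M : 'I_r -> 'rV[R]_2) (n q : nat)
    (z : 'I_q -> 'rV[R]_2) : Prop :=
  (forall i, working_board B n (z i)) /\
  (forall i k, i != k -> ~ attacks M (z i) (z k)).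

Definition det2 u v : R := \det (col_mx u v : 'M[R]_(1 + 1)).

End Geometry.

Section CombinatorialTypes.
Variables (r q : nat).

(* Triples (i, j, k) of a piece, a move and a different piece. *)
Definition triple := {t : 'I_q * 'I_r * 'I_q | t.1.1 != t.2}.

Definition piece1 (t : triple) : 'I_q := (val t).1.1.
Definition move_of (t : triple) : 'I_r := (val t).1.2.
Definition piece2 (t : triple) : 'I_q := (val t).2.

(* true stands for left, false for right. *)
Definition labelled_type := {ffun triple -> bool}.

Fact relabel_triple_subproof (s : {perm 'I_q}) (t : triple) :
  (s (piece1 t), move_of t, s (piece2 t)).1.1
    != (s (piece1 t), move_of t, s (piece2 t)).2.
Proof. by rewrite /= (inj_eq perm_inj); exact: valP t. Qed.

Definition relabel_triple (s : {perm 'I_q}) (t : triple) : triple :=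
  exist _ (s (piece1 t), move_of t, s (piece2 t)) (relabel_triple_subproof s t).

Definition relabel (s : {perm 'I_q}) (T : labelled_type) : labelled_type :=
  [ffun t => T (relabel_triple s t)].

Definition unlabelled (T : labelled_type) : {set labelled_type} :=
  [set relabel s T | s : {perm 'I_q}]%SET.

Definition reorient (S : {set 'I_r}) (T : labelled_type) : labelled_type :=
  [ffun t => (move_of t \in S) (+) T t].

Definition eq_labelled_reorient (A A' : {set labelled_type}) : Prop :=
  exists S : {set 'I_r}, A' = [set reorient S T | T in A]%SET.

Definition eq_unlabelled_reorient (A A' : {set {set labelled_type}}) : Prop :=
  exists S : {set 'I_r},
    A' = [set [set reorient S T | T in C] | C : {set labelled_type} in A]%SET.

End CombinatorialTypes.

Section TypesOfRiders.
Variables (R : realType) (B : set 'rV[R]_2) (r : nat) (M : 'I_r -> 'rV[R]_2).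
Variable q : nat.

Definition type_of (z : 'I_q -> 'rV[R]_2) : labelled_type r q :=
  [ffun t => 0 < det2 (M (move_of t)) (z (piece2 t) - z (piece1 t))].

Definition labelled_types : {set labelled_type r q} :=
  [set T | `[< exists (n : nat) (z : 'I_q -> 'rV[R]_2),
      [/\ (1 <= n)%N, nonattacking B M n z & T = type_of z] >]]%SET.

Definition unlabelled_types : {set {set labelled_type r q}} :=
  [set unlabelled T | T in labelled_types]%SET.

End TypesOfRiders.

(* Main.v *)
(* Types are sign patterns of det(m_j, z_k - z_i). Over R these patterns do not
   see the board: being open, homogeneous and translation invariant, they are
   already realized by integer points in a large dilation. Given two triples of
   pairwise nonparallel vectors, some invertible linear map sends each line
   spanned by m_j to the line spanned by m'_j, and it multiplies
   det(m_j, v) by a nonzero constant depending only on j, whose sign gives the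
   reorientation. *)
Require Import Defs.
From mathcomp Require Import all_boot all_order all_algebra all_fingroup.
From mathcomp Require Import all_classical all_reals all_analysis.
From mathcomp Require Import ring lra.
Import numFieldNormedType.Exports.

Set Implicit Arguments.
Unset Strict Implicit.
Unset Printing Implicit Defensive.

Import Order.TTheory GRing.Theory Num.Theory.
Local Open Scope ring_scope.

(** * Planar determinants and parallelism *)

Section PlanarDeterminant.
Variable R : realType.
Implicit Types (u v w : 'rV[R]_2) (A : 'M[R]_2).

Lemma det2E u v : det2 u v = u 0 0 * v 0 1 - u 0 1 * v 0 0.
Proof.
rewrite /det2 (expand_det_row _ (lshift 1 0)) !big_ord_recl big_ord0 /cofactor.
rewrite !(@det_mx11 _) !mxE /=.
have -> : @lift (1 + 1) (lshift 1 0) (0 : 'I_1) = rshift 1 0 by apply/val_inj.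
rewrite (unsplitK (inl 0 : 'I_1 + 'I_1)) (unsplitK (inr 0 : 'I_1 + 'I_1)).
have -> : lift ord0 0 = 1 :> 'I_2 by apply/val_inj.
have -> : lift 1 0 = 0 :> 'I_2 by apply/val_inj.
by rewrite addr0 expr0 mul1r expr1 mulN1r mulrN.
Qed.

Lemma det2_mulmx u v A : det2 (u *m A) (v *m A) = det2 u v * \det A.
Proof. by rewrite /det2 -mul_col_mx det_mulmx. Qed.

Lemma det2Zl (c : R) u v : det2 (c *: u) v = c * det2 u v.
Proof. by rewrite !det2E !mxE; ring. Qed.

Lemma det2Zr (c : R) u v : det2 u (c *: v) = c * det2 u v.
Proof. by rewrite !det2E !mxE; ring. Qed.

(** Cramer's rule for [w] in the basis [u], [v], cleared of denominators so that it is a polynomial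
    identity valid for dependent vectors too. *)
Lemma det2_cramer u v w :
  det2 u v *: w = det2 w v *: u + det2 u w *: v.
Proof.
apply/rowP => i; rewrite !mxE !det2E.
have [->|->] : i = 0 \/ i = 1; last by ring.
  by case: i => [[|[|//]] ?]; [left|right]; apply/val_inj.
by ring.
Qed.

Lemma parallel_det2 u v : u != 0 -> parallel u v <-> det2 u v = 0.
Proof.
move=> u0; split=> [[c ->]|duv].
  by rewrite det2Zr det2E mulrC (mulrC (u 0 0)) subrr mul0r.
(* A coordinate vector [e] completes [u] to a basis; in it, [det2 u v = 0] kills the [e]-component
   of [v]. *)
have [e de] : exists e, det2 u e != 0.
  have [u00|u00] := eqVneq (u 0 0) 0; last first.
    exists (\row_j (j == 1)%:R); rewrite det2E !mxE /=.
    by rewrite mulr1 mulr0 subr0.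
  have [u01|u01] := eqVneq (u 0 1) 0; last first.
    exists (\row_j (j == 0)%:R); rewrite det2E !mxE /=.
    by rewrite mulr1 mulr0 sub0r oppr_eq0.
  case/eqP: u0; apply/rowP => i; rewrite mxE.
  by case: i => [[|[|//]] ?]; [rewrite -u00|rewrite -u01];
    congr (u _ _); apply/val_inj.
exists (det2 v e / det2 u e).
apply: (scalerI de); rewrite (det2_cramer u e v) duv scale0r addr0 scalerA.
by rewrite mulrCA divff// mulr1.
Qed.

End PlanarDeterminant.

(** * Realizing real sign patterns on a board *)

Section Realizability.
Variable R : realType.
Implicit Types (B : set 'rV[R]_2).

(** For a move set, this is the nonattacking condition freed from the board and from the integer
    lattice. *)
Definition general_position (r q : nat) (M : 'I_r -> 'rV[R]_2)
    (z : 'I_q -> 'rV[R]_2) : Prop :=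
  forall i k j, i != k -> det2 (M j) (z k - z i) != 0.

Lemma attacksP (r : nat) (M : 'I_r -> 'rV[R]_2) (u v : 'rV[R]_2) :
  move_set M -> attacks M u v <-> exists j, det2 (M j) (v - u) = 0.
Proof.
case=> M0 _; split=> -[j].
  by move=> h; exists j; apply/(parallel_det2 _ (M0 j)).
by move/(parallel_det2 _ (M0 j)); exists j.
Qed.

(** Rounding down the coordinates of [n.+1%:R *: y] costs less than 1, hence less than [n.+1%:R^-1]
    after rescaling. The factor [n.+1] is the dilation factor of the working board of order [n]. *)
Lemma integer_approximation (y : 'rV[R]_2) :
  exists a : nat -> 'rV[int]_2,
    (n.+1%:R^-1 *: map_mx intr (a n) @[n --> \oo] --> y)%classic.
Proof.
exists (fun n => \row_i Num.floor (n.+1%:R * y 0 i)).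
apply/cvg_ballP => e e0.
near=> n.
split=> // i j; rewrite (ord1 i) -ball_normE /= !mxE.
have n0 : 0 < n.+1%:R :> R by rewrite ltr0n.
rewrite -[y 0 j](mulKf (lt0r_neq0 n0)) -mulrBr normrM gtr0_norm ?invr_gt0//.
apply: le_lt_trans (_ : n.+1%:R^-1 < e); last first.
  by near: n; exact: (near_infty_natSinv_lt (PosNum e0)).
rewrite ler_piMr ?invr_ge0 ?ltW// mulKf ?gt_eqF//.
have := floor_itv (n.+1%:R * y 0 j); rewrite intrD => /andP[fl fu].
by rewrite ger0_norm; lra.
Unshelve. all: by end_near. Qed.

Lemma cvg_det2 (u v w : 'rV[R]_2) (f g : nat -> 'rV[R]_2) :
  (f n @[n --> \oo] --> v)%classic -> (g n @[n --> \oo] --> w)%classic ->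
  (det2 u (f n - g n) @[n --> \oo] --> det2 u (v - w))%classic.
Proof.
move=> fv gw.
have fvi i : (f n 0 i @[n --> \oo] --> v 0 i)%classic.
  by move=> U /coord_continuous/fv.
have gwi i : (g n 0 i @[n --> \oo] --> w 0 i)%classic.
  by move=> U /coord_continuous/gw.
rewrite det2E !mxE; under eq_fun do rewrite det2E !mxE.
by apply: cvgB; apply: cvgMl_tmp; apply: cvgB.
Qed.

(** As [e] tends to 0 each [x + e *: z i] tends to the interior point [x]; there are finitely many
    pieces, so one term of the harmonic sequence serves them all. *)
Lemma shrink_into_interior B (q : nat) (z : 'I_q -> 'rV[R]_2) :
  (interior B !=set0)%classic ->
  exists (x : 'rV[R]_2) (e : R), 0 < e /\ forall i, (interior B (x + e *: z i)).
Proof.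
move=> [x Bx]; exists x.
have : (\forall n \near \oo, forall i,
    interior B (x + (harmonic n : R) *: z i))%classic.
  apply: filter_forall => i.
  have : (x + (harmonic n : R) *: z i @[n --> \oo] --> x)%classic.
    rewrite -[X in (_ --> X)%classic]addr0 -(scale0r (z i)).
    by apply: cvgD; [exact: cvg_cst|apply: cvgZr_tmp; exact: cvg_harmonic].
  by apply; apply: open_nbhs_nbhs; split => //; exact: open_interior.
case=> n _ /(_ n (leqnn n)) Bn; exists (harmonic n); split=> //.
by rewrite /harmonic /= invr_gt0 ltr0n.
Qed.

(** The right-hand side does not mention [B]. To realize a real configuration, shrink it into the
    interior and approximate it by lattice points over [n.+1]: finitely many strict inequalities
    survive for large [n]. *)
Lemma labelled_typesP B (r q : nat) (M : 'I_r -> 'rV[R]_2)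
    (T : labelled_type r q) :
  (interior B !=set0)%classic -> move_set M ->
  T \in labelled_types B M q <->
  exists z : 'I_q -> 'rV[R]_2, general_position M z /\ T = type_of M z.
Proof.
move=> B0 hM; rewrite inE; split=> [/asboolP[n [z [_ [_ hz] ->]]]|[z [gz ->]]].
  exists z; split=> // i k j ik; apply/eqP => d0; apply: (hz i k ik).
  by apply/attacksP => //; exists j.
have [x [e [e0 Bz]]] := shrink_into_interior z B0.
have [a ha] := choice (fun i => integer_approximation (x + e *: z i)).
pose y n i := n.+1%:R^-1 *: map_mx intr (a i n) : 'rV[R]_2.
have near_board : (\forall n \near \oo, forall i, interior B (y n i))%classic.
  apply: filter_forall => i; have := ha i; apply.
  by apply: open_nbhs_nbhs; split => //; exact: open_interior.
(* A positive product says that both determinants are nonzero with equal signs, an open condition on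
   [y n] that covers left and right at once. *)
have near_sign : (\forall n \near \oo, forall t : triple r q,
     0 < det2 (M (move_of t)) (z (piece2 t) - z (piece1 t)) *
         det2 (M (move_of t)) (y n (piece2 t) - y n (piece1 t)))%classic.
  apply: filter_forall => t.
  set m := M _; set k := piece2 t; set i := piece1 t.
  have lim : (det2 m (z k - z i) * det2 m (y n k - y n i) @[n --> \oo] -->
      det2 m (z k - z i) * det2 m (x + e *: z k - (x + e *: z i)))%classic.
    by apply: cvgMl_tmp; exact: (cvg_det2 (ha k) (ha i)).
  (* The translation by [x] cancels, and the product is [e] times the square of a nonzero
     determinant. *)
  have : 0 < det2 m (z k - z i) * det2 m (x + e *: z k - (x + e *: z i)).
    have -> : x + e *: z k - (x + e *: z i) = e *: (z k - z i).
      by rewrite opprD addrACA subrr add0r scalerBr.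
    rewrite det2Zr mulrCA mulr_gt0// -expr2 exprn_even_gt0//=.
    exact: gz (valP t).
  exact: cvgr_gt lim _.
have [n [n1 By gy]] : exists n, [/\ (1 <= n)%N, forall i, interior B (y n i) &
    forall t : triple r q,
      0 < det2 (M (move_of t)) (z (piece2 t) - z (piece1 t)) *
          det2 (M (move_of t)) (y n (piece2 t) - y n (piece1 t))].
  near \oo%classic => n; exists n; split; last by near: n.
    by near: n; exact: nbhs_infty_ge.
  by near: n.
have n0 : 0 < n.+1%:R :> R by rewrite ltr0n.
have aE i : map_mx intr (a i n) = n.+1%:R *: y n i.
  by rewrite scalerA divff ?scale1r// gt_eqF.
have dE i j k : det2 (M j) (map_mx intr (a k n) - map_mx intr (a i n)) =
    n.+1%:R * det2 (M j) (y n k - y n i).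
  by rewrite !aE -scalerBr det2Zr.
(* The integer configuration is [y n] dilated by [n.+1], a positive factor that changes no sign. *)
apply/asboolP; exists n, (fun i => map_mx intr (a i n)); split=> //.
  split=> [i|i k ik].
    by split; [exists (y n i) => //; rewrite aE|exists (a i n)].
  case/attacksP => // j; rewrite dE => /eqP; rewrite mulf_eq0 gt_eqF//= => /eqP d0.
  have := gy (Sub (i, j, k) ik).
  by rewrite /piece1 /piece2 /move_of SubK /= d0 mulr0 ltxx.
apply/ffunP => t; rewrite !ffunE dE pmulr_rgt0//.
have := gy t.
have [d0|d0|<-] := ltrgtP 0 (det2 _ (z (piece2 t) - _)).
- by rewrite pmulr_rgt0.
- by rewrite nmulr_rgt0// => /lt_gtF ->.
- by rewrite mul0r ltxx.
Unshelve. all: by end_near. Qed.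

End Realizability.

(** * Linear maps between triples of directions *)

Section ThreeMoves.
Variable R : realType.

Lemma move_set_det2_neq0 (r : nat) (M : 'I_r -> 'rV[R]_2) j k :
  move_set M -> j != k -> det2 (M j) (M k) != 0.
Proof.
move=> [M0 Mp] jk; apply/eqP => /(parallel_det2 _ (M0 j)).
exact: Mp.
Qed.

(* PGL_2 is transitive on triples of distinct points of the projective line. *)
Lemma three_directions (M M' : 'I_3 -> 'rV[R]_2) :
  move_set M -> move_set M' ->
  exists (A : 'M[R]_2) (c : 'I_3 -> R), A \in unitmx /\
    forall j, c j != 0 /\ M j *m A = c j *: M' j.
Proof.
move=> hM hM'.
have D := fun j k => @move_set_det2_neq0 _ M j k hM.
have D' := fun j k => @move_set_det2_neq0 _ M' j k hM'.
pose i0 : 'I_3 := inord 0; pose i1 : 'I_3 := inord 1; pose i2 : 'I_3 := inord 2.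
have [n01 n02 n21] : [/\ i0 != i1, i0 != i2 & i2 != i1].
  by rewrite -!val_eqE /= !inordK.
(* Ratios of the Cramer coefficients of M' i2 and M i2, so that A maps the third
   vector to a multiple of M' i2 as well. *)
pose a := det2 (M' i2) (M' i1) / det2 (M i2) (M i1).
pose b := det2 (M' i0) (M' i2) / det2 (M i0) (M i2).
pose d := det2 (M' i0) (M' i1) / det2 (M i0) (M i1).
have [a0 b0 d0] : [/\ a != 0, b != 0 & d != 0].
  by rewrite !mulf_neq0 ?invr_eq0 ?D ?D'.
pose P : 'M[R]_2 := col_mx (M i0) (M i1).
have Pu : P \in unitmx by rewrite unitmxE unitfE; exact: D.
pose Q : 'M[R]_2 := col_mx (a *: M' i0) (b *: M' i1).
have PA : P *m (invmx P *m Q) = Q by rewrite mulmxA mulmxV// mul1mx.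
exists (invmx P *m Q), (fun j => if j == i0 then a else if j == i1 then b else d).
split.
  rewrite unitmx_mul unitmx_inv Pu unitmxE unitfE.
  rewrite -/(det2 _ _) det2Zl det2Zr mulf_neq0// mulf_neq0//.
  exact: D'.
have [A0 A1] : M i0 *m (invmx P *m Q) = a *: M' i0 /\
    M i1 *m (invmx P *m Q) = b *: M' i1.
  by apply: eq_col_mx; rewrite -mul_col_mx.
have jE j : [\/ j = i0, j = i1 | j = i2].
  case: j => [[|[|[|//]]] ?]; [apply: Or31|apply: Or32|apply: Or33];
  by apply/val_inj; rewrite /= inordK.
move=> j; have [->|->|->] := jE j.
- by rewrite eqxx.
- by rewrite (eq_sym i1) (negbTE n01) eqxx.
rewrite (eq_sym i2 i0) (negbTE n02) (negbTE n21); split=> //.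
(* After multiplication by [det2 (M i0) (M i1)], Cramer's rule expands [M i2] in [M i0] and [M i1];
   [a] and [b] turn the image's coefficients into those of [M' i2], and the rule read backwards
   gives the factor [d]. *)
apply: (scalerI (D i0 i1 n01)).
rewrite scalemxAl (det2_cramer (M i0) (M i1) (M i2)) mulmxDl -!scalemxAl A0 A1.
rewrite !scalerA ![det2 (M _) _ * _]mulrC !divfK ?D//.
exact/esym/det2_cramer.
Qed.

End ThreeMoves.

(** * Reorientation of types *)

Section Reorientation.
Variables (r q : nat).

Lemma reorientK (S : {set 'I_r}) :
  involutive (@reorient r q S).
Proof. by move=> T; apply/ffunP => t; rewrite !ffunE addbA addbb addFb. Qed.

(** Relabelling permutes pieces and fixes the move of each triple, so it commutes with
    reorientation. *)
Lemma unlabelled_reorient (S : {set 'I_r}) (T : labelled_type r q) :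
  unlabelled (reorient S T) = [set reorient S U | U in unlabelled T]%SET.
Proof.
rewrite /unlabelled -imset_comp; apply: eq_imset => s /=.
by apply/ffunP => t; rewrite !ffunE.
Qed.

End Reorientation.

(** The factor depends on the move alone, so a negative [s j] flips every value at move [j]. General
    position rules out zero determinants, for which a sign change would not flip the recorded
    value. *)
Lemma type_of_proportional (R : realType) (r q : nat)
    (M M' : 'I_r -> 'rV[R]_2) (z z' : 'I_q -> 'rV[R]_2) (s : 'I_r -> R) :
  (forall j, s j != 0) ->
  (forall i j k, det2 (M' j) (z' k - z' i) = s j * det2 (M j) (z k - z i)) ->
  general_position M z ->
  general_position M' z' /\
  type_of M' z' = reorient [set j | s j < 0] (type_of M z).
Proof.
move=> s0 sE gz; split=> [i k j ik|]; first by rewrite sE mulf_neq0 ?gz.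
apply/ffunP => t; rewrite !ffunE inE sE.
have dn := gz _ _ (move_of t) (valP t).
have [sn|sp|e] := ltrgtP (s (move_of t)) 0; last by move: (s0 (move_of t)); rewrite e eqxx.
  by rewrite nmulr_rgt0// addTb -leNgt le_eqVlt (negbTE dn).
by rewrite pmulr_rgt0.
Qed.

Theorem theorem4p1 (R : realType) (B : set 'rV[R]_2) (hB : board B)
    (q : nat) (hq : (1 <= q)%N) (M M' : 'I_3 -> 'rV[R]_2)
    (hM : move_set M) (hM' : move_set M') :
  #|unlabelled_types B M q| = #|unlabelled_types B M' q| /\
  eq_labelled_reorient (labelled_types B M q) (labelled_types B M' q) /\
  eq_unlabelled_reorient (unlabelled_types B M q) (unlabelled_types B M' q).
Proof.
have [_ B0] := hB.
have [A [c [Au cA]]] := three_directions hM hM'.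
have A0 : \det A != 0 by rewrite -unitfE -unitmxE.
(* Comes from [c j * det2 (M' j) (v *m A) = det2 (M j *m A) (v *m A) = det2 (M j) v * \det A]. *)
pose s j := \det A / c j.
have s0 j : s j != 0 by rewrite mulf_neq0// invr_eq0; case: (cA j).
have sE j v : det2 (M' j) (v *m A) = s j * det2 (M j) v.
  have [c0 MA] := cA j; apply: (mulfI c0).
  by rewrite -det2Zl -MA det2_mulmx /s mulrA mulrCA divff// mulr1 mulrC.
pose S := [set j | s j < 0].
have LE : labelled_types B M' q = [set reorient S T | T in labelled_types B M q]%SET.
  apply/setP => T; apply/idP/imsetP.
    (* Pulling back by [invmx A] gives the factors [(s j)^-1], which have the signs of [s j] and
       hence the same [S]; reorienting twice by [S] restores the type. *)
    move=> /(labelled_typesP _ B0 hM')[z [gz ->]].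
    have vE i j k : det2 (M j) (z k *m invmx A - z i *m invmx A) =
        (s j)^-1 * det2 (M' j) (z k - z i).
      by apply: (mulfI (s0 j)); rewrite -sE -mulmxBl mulmxKV// mulVKf.
    have [|gz' zE] := type_of_proportional _ vE gz.
      by move=> j; rewrite invr_eq0.
    exists (type_of M (fun i => z i *m invmx A)).
      by apply/labelled_typesP => //; eexists; split; first exact: gz'.
    rewrite zE; have -> : [set j | (s j)^-1 < 0] = S.
      by apply/setP => j; rewrite !inE invr_lt0.
    by rewrite reorientK.
  case=> U /(labelled_typesP _ B0 hM)[z [gz ->]] ->.
  have vE i j k : det2 (M' j) (z k *m A - z i *m A) =
      s j * det2 (M j) (z k - z i).
    by rewrite -sE mulmxBl.
  have [gz' zE] := type_of_proportional s0 vE gz.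
  by apply/labelled_typesP => //; eexists; split; [exact: gz'|].
have UE : unlabelled_types B M' q =
    [set [set reorient S T | T in C] |
      C : {set labelled_type 3 q} in unlabelled_types B M q]%SET.
  rewrite /unlabelled_types LE -!imset_comp.
  by apply: eq_imset => T; exact: unlabelled_reorient.
split; last by split; exists S.
(* Reorientation is an involution on labelled types, so it acts injectively on sets of them, and the
   count of classes is preserved. *)
rewrite UE; apply/esym/card_imset => C C'.
exact: (imset_inj (inv_inj (@reorientK _ _ S))).
Qed.
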